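(* For every integer $n\ge 0$, $\overline{p}_3(16n+14)\equiv 0 \pmod{32}$.
   Context: An overpartition of $n$ is a partition of $n$ in which the first occurrence of each distinct part may (or may not) be overlined. An overpartition triple of $n$ is a triple of overpartitions whose parts together sum to $n$. $\overline{p}_3(n)$ denotes the number of overpartition triples of $n$, with $\overline{p}_3(0)=1$; equivalently $\sum_{n\ge0}\overline{p}_3(n)q^n=\big((-q;q)_\infty/(q;q)_\infty\big)^3$, where $(a;q)_\infty=\prod_{n\ge0}(1-aq^n)$. *)

(* Defs.v *)
From mathcomp Require Import all_boot.

Set Implicit Arguments.
Unset Strict Implicit.
Unset Printing Implicit Defensive.

(* A part is a pair (size, overlined?), and parts are listed in weakly
   decreasing order of size. Since equal sizes are adjacent, a part is the
   first occurrence of its size iff its predecessor is strictly larger; so a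
   part equal to its predecessor must not be overlined. *)
Definition follows (x y : nat * bool) : bool :=
  (y.1 < x.1) || ((y.1 == x.1) && ~~ y.2).

Definition is_overpartition (s : seq (nat * bool)) : bool :=
  (0 \notin unzip1 s) && sorted follows s.

Definition weight (s : seq (nat * bool)) : nat := sumn (unzip1 s).

(* A total weight n bounds every part and the number of parts by n, so counting
   within this finite type loses nothing (see is_overpartition_bounded). *)
Definition bounded_seq (n : nat) : finType := n.-bseq ('I_n.+1 * bool).

Definition parts (n : nat) (s : bounded_seq n) : seq (nat * bool) :=
  [seq (val x.1, x.2) | x <- bseqval s].

Definition overpartition_triples (n : nat)
    : {set bounded_seq n * bounded_seq n * bounded_seq n} :=
  [set t | [&& is_overpartition (parts t.1.1),
               is_overpartition (parts t.1.2),
               is_overpartition (parts t.2) &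
               weight (parts t.1.1) + weight (parts t.1.2)
                 + weight (parts t.2) == n]].

Definition pbar3 (n : nat) : nat := #|overpartition_triples n|.

Lemma is_overpartition_bounded (n : nat) (s : seq (nat * bool)) :
  is_overpartition s -> weight s <= n ->
  exists t : bounded_seq n, parts t = s.
Proof.
case/andP=> s0 _ sn.
have sz : size s <= weight s.
  rewrite /weight; elim: s s0 {sn} => //= -[[|a] b] s IH //=.
  by rewrite inE => /= /IH h; rewrite addSn ltnS (leq_trans h) ?leq_addl.
have le x : x \in s -> x.1 <= weight s.
  rewrite /weight; elim: s {s0 sn sz} => //= y s IH; rewrite inE.
  case/predU1P=> [->|/IH h]; first exact: leq_addr.
  by rewrite (leq_trans h) ?leq_addl.
pose t := [seq (inord x.1 : 'I_n.+1, x.2) | x <- s].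
have tn : size t <= n by rewrite size_map (leq_trans sz).
exists (Bseq tn); rewrite /parts /= /t -map_comp -[RHS]map_id.
apply/eq_in_map=> -[a b] /le /= ab.
by rewrite inordK // ltnS (leq_trans ab).
Qed.

Lemma parts_inj (n : nat) : injective (@parts n).
Proof.
move=> s t st; apply/val_inj/(inj_map _ st) => -[a b] [c d] /= [ac ->].
by congr (_, _); apply: val_inj.
Qed.

(* Main.v *)
(* Gauss's identity (q;q)/(-q;q) = sum_k (-1)^k q^(k^2) =: phi turns the generating
   function into 1/phi^3. Write phi = 1 + 2s with s = sum_(k >= 1) (-1)^k q^(k^2).
   Since phi^16 = 1 mod 32, the series is congruent to
   phi^13 = 1 + 26 s + 24 s^2 + 16 s^3 + 16 s^4 mod 32, where in the last two terms
   s^3 and s^4 only matter mod 2, that is s^3 = sum +-q^(a^2 + 2 b^2) and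
   s^4 = sum q^(4 a^2). No integer 16n + 14 is of the form a^2, a^2 + b^2,
   a^2 + 2 b^2 or 4 a^2, as one sees modulo 16.

   Gauss's identity is the limit of
   sum_k (-1)^k q^(k^2) / ((q;q)_(n-k) (q;q)_(n+k)) = 1 / (q^2;q^2)_n,
   in which denominators are cleared by (q;q)_M^2 for a fixed M >= 2n. *)
Require Import Defs.
From mathcomp Require Import all_boot all_order all_algebra.
From mathcomp Require Import ring zify.

Set Implicit Arguments.
Unset Strict Implicit.
Unset Printing Implicit Defensive.

Import GRing.Theory.

(** * Recursive enumeration of overpartitions *)

(* The sequences of weight n that may follow a part of size m in an
   overpartition, grouped by their head: the part m again (not overlined), the
   overlined part m - 1, or what may also follow m - 1. The fuel f must be at
   least m + n. *)
Fixpoint tails (f m n : nat) : seq (seq (nat * bool)) :=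
  if f is f'.+1 then
    if m is m'.+1 then
      (if m <= n then [seq (m, false) :: t | t <- tails f' m (n - m)] else [::])
      ++ (if 0 < m' <= n then [seq (m', true) :: t | t <- tails f' m' (n - m')]
          else [::])
      ++ tails f' m' n
    else if n == 0 then [:: [::]] else [::]
  else if n == 0 then [:: [::]] else [::].

Lemma mem_map_cons (T : eqType) (x : T) (l : seq (seq T)) (s : seq T) :
  (s \in [seq x :: t | t <- l]) =
  if s is y :: t then (y == x) && (t \in l) else false.
Proof.
apply/mapP/idP => [[t tl ->]|]; first by rewrite eqxx.
by case: s => // y t /andP[/eqP-> tl]; exists t.
Qed.

(** The entry [(m, false)] stands for a preceding part of size [m]; its flag is immaterial, since
    [follows] reads only the size of its first argument. The proof compares the head of [s] with [m]
    and its predecessor. *)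
Lemma mem_tails f m n s : m + n <= f ->
  (s \in tails f m n) =
  [&& 0 \notin unzip1 s, path follows (m, false) s & weight s == n].
Proof.
elim: f m n s => [|f IH] m n s.
  rewrite leqn0 addn_eq0 => /andP[/eqP-> /eqP->].
  case: s => [|[k b] s]; rewrite //= !inE /follows /weight /=.
  by case: k => //= k; case: b; rewrite /= andbF.
case: m => [|m] fE /=.
  case: s => [|[k b] s]; first by case: n {fE}.
  by case: eqP => _; rewrite !inE /follows /weight /=; case: k; rewrite /= ?andbF.
rewrite !mem_cat (IH m n); last lia.
have -> : (s \in (if 0 < m <= n
                 then [seq (m, true) :: t | t <- tails f m (n - m)] else [::]))
  = if s is (k, b) :: t then [&& k == m, b, 0 < m & (0 \notin unzip1 t) &&
    (path follows (m, false) t) && (weight s == n)] else false.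
  case: ifP => H; last first.
    case: s => [|[k b] t] //.
    apply/esym/negP => /and4P[/eqP-> _ m0 /andP[_]]; rewrite /weight /=; lia.
  rewrite mem_map_cons; case: s => [|[k b] t] //; rewrite IH; last lia.
  rewrite xpair_eqE -!andbA; case: eqP => //= ->; case: b => //=.
  case/andP: H => -> mn /=; congr [&& _, _ & _]; rewrite /weight /=; lia.
have -> : (s \in (if m < n
    then [seq (m.+1, false) :: t | t <- tails f m.+1 (n - m.+1)] else [::]))
  = if s is (k, b) :: t then [&& k == m.+1, ~~ b & (0 \notin unzip1 t) &&
    (path follows (m.+1, false) t) && (weight s == n)] else false.
  case: ifP => H; last first.
    case: s => [|[k b] t] //.
    apply/esym/negP => /and3P[/eqP-> _ /andP[_]]; rewrite /weight /=; lia.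
  rewrite mem_map_cons; case: s => [|[k b] t] //; rewrite IH; last lia.
  rewrite xpair_eqE -!andbA; case: eqP => //= ->; case: b => //=.
  congr [&& _, _ & _]; rewrite /weight /=; lia.
case: s => [|[k b] t] //=.
rewrite inE negb_or.
have fE' x y u v : follows (x, y) (u, v) = (u < x) || ((u == x) && ~~ v) by [].
have pf x y : path follows (x, y) t = path follows (x, false) t by case: t.
rewrite !fE' !pf !(eq_sym 0 k).
case: (ltngtP k m.+1) => [km|km|->]; rewrite ?andbF /=.
- rewrite (ltnS k m) in km; case: (ltngtP k m) km => //= -> _.
  by case: b => /=; case: m fE IH => [|m] fE IH; rewrite /= ?andbF ?orbF -?andbA.
- have -> : (k < m) = false by [lia]; have -> : (k == m) = false by [lia].
  by rewrite /= !andbF.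
have -> : (m.+1 == m) = false by lia.
have -> : (m.+1 < m) = false by lia.
by case: b => //=; rewrite ?andbF ?orbF -?andbA.
Qed.

(** The three blocks are disjoint: the first two have different heads, and a member of the third
    follows a part of size [m'], so it starts neither with [m] nor with an overlined [m']. *)
Lemma tails_uniq f m n : m + n <= f -> uniq (tails f m n).
Proof.
elim: f m n => [|f IH] m n; first by case: m; case: n.
case: m => [|m] fE /=; first by case: n {fE}.
have ci (x : nat * bool) : injective (cons x) by move=> ? ? [].
have ui x k : k + (n - k) <= f -> uniq [seq x :: t | t <- tails f k (n - k)].
  by move=> ?; rewrite map_inj_uniq ?IH.
rewrite !cat_uniq IH ?andbT; last lia.
apply/and4P; split.
- by case: ifP => // ?; apply: ui; lia.
- rewrite has_cat negb_or; apply/andP; split; apply/hasPn => s.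
    case: ifP => // _; rewrite mem_map_cons; case: s => // y s /andP[/eqP-> _].
    by case: ifP => // _; rewrite mem_map_cons xpair_eqE andbF.
  rewrite mem_tails; last lia; case: s => [|[k b] s].
    by case: ifP; rewrite // mem_map_cons.
  case/and3P=> _ /andP[h _] _; case: ifP => // _; rewrite mem_map_cons.
  by apply/negP => /andP[/eqP[kE _]]; move: h; rewrite /follows kE /=; lia.
- by case: ifP => // ?; apply: ui; lia.
apply/hasPn => s; rewrite mem_tails; last lia.
case: s => [|[k b] s]; first by case: ifP; rewrite // mem_map_cons.
case/and3P=> _ /andP[h _] _; case: ifP => // _; rewrite mem_map_cons.
by apply/negP => /andP[/eqP[kE bE]]; move: h; rewrite /follows kE bE /=; lia.
Qed.

Definition ntails m n := size (tails (m + n) m n).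

Lemma size_tails f m n : m + n <= f -> size (tails f m n) = ntails m n.
Proof.
move=> fE; apply: perm_size; apply: uniq_perm; rewrite ?tails_uniq // => s.
by rewrite !mem_tails.
Qed.

Lemma ntails0 n : ntails 0 n = (n == 0).
Proof. by case: n. Qed.

Lemma ntailsS m n : ntails m.+1 n =
  (if m < n then ntails m.+1 (n - m.+1) else 0)
  + (if 0 < m <= n then ntails m (n - m) else 0) + ntails m n.
Proof.
rewrite {1}/ntails addSn /= !size_cat size_tails // addnA; congr (_ + _ + _).
  by case: ifP => // ?; rewrite size_map size_tails //; lia.
by case: ifP => // ?; rewrite size_map size_tails //; lia.
Qed.

Lemma card_overpartitions N n : n <= N ->
  #|[set s : bounded_seq N |
      is_overpartition (parts s) && (weight (parts s) == n)]| = ntails N.+1 n.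
Proof.
move=> nN; rewrite cardE -(size_map (@parts N)); apply: perm_size.
apply: uniq_perm; rewrite ?tails_uniq ?map_inj_uniq ?enum_uniq //; first exact: parts_inj.
move=> s; rewrite mem_tails //.
(* All parts are at most [n <= N], so a preceding part [N.+1] does not constrain the head. *)
have fw : weight s == n -> path follows (N.+1, false) s = sorted follows s.
  case: s => [|[k b] s] //=; rewrite /follows /weight /= => h.
  by have -> : k < N.+1 by lia.
have -> : [&& 0 \notin unzip1 s, path follows (N.+1, false) s & weight s == n]
  = is_overpartition s && (weight s == n).
  by rewrite /is_overpartition; case: eqP => [/eqP/fw->|_]; rewrite ?andbT ?andbF.
apply/mapP/idP => [[t]|/andP[os /eqP ws]].
  by rewrite mem_enum inE => ? ->.
have [|t ts] := @is_overpartition_bounded N s os; first by rewrite ws.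
by exists t; rewrite // mem_enum inE ts os ws eqxx.
Qed.

Local Open Scope ring_scope.

(** * Finite form of Gauss's identity *)

Section FiniteGauss.
Variables (R : comNzRingType) (q : R) (M : nat).

(** For [m <= M] this is (q;q)_M / (q;q)_m, the reciprocal of (q;q)_m with its denominator
    cleared. *)
Definition qtail m : R := \prod_(m <= i < M) (1 - q ^+ i.+1).

Definition gauss_term n k : R :=
  (-1) ^+ k * q ^+ (k ^ 2)%N * qtail (n - k) * qtail (n + k).

(** The terms at k and -k agree, hence the factor 2; the separate cutoff [K] allows partial sums to
    telescope. *)
Definition gauss_sum n K : R :=
  gauss_term n 0 + 2 * \sum_(k < K) gauss_term n k.+1.

Lemma qtailS m : (m < M)%N -> qtail m = (1 - q ^+ m.+1) * qtail m.+1.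
Proof. by move=> mM; rewrite /qtail big_ltn. Qed.

(* Reversing k to - k - 1 negates (-1)^k q^(k^2 + k) qtail(n - k) qtail(n + 1 + k);
   in terms of k >= 0 the cancellation becomes a telescoping sum. *)
Lemma gauss_sum_telescope n K : (K <= n)%N -> (2 * n.+1 <= M)%N ->
  (1 - q ^+ (2 * n.+1)%N) * gauss_sum n.+1 K - gauss_sum n K =
  2 * q ^+ n.+1 * ((-1) ^+ K * q ^+ (K ^ 2 + K)%N * qtail (n - K)
                   * qtail (n.+1 + K)).
Proof.
move=> Kn nM; elim: K Kn => [_|K IH Kn].
  rewrite /gauss_sum /gauss_term !big_ord0 !subn0 !addn0 (qtailS (m := n)); last lia.
  rewrite (_ : 2 * n.+1 = n.+1 + n.+1)%N ?exprD; last lia.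
  ring.
have sumS L : gauss_sum L K.+1 = gauss_sum L K + 2 * gauss_term L K.+1.
  by rewrite /gauss_sum big_ord_recr /= mulrDr addrA.
rewrite !sumS.
have ->: (1 - q ^+ (2 * n.+1)%N) *
    (gauss_sum n.+1 K + 2 * gauss_term n.+1 K.+1)
   - (gauss_sum n K + 2 * gauss_term n K.+1) =
  ((1 - q ^+ (2 * n.+1)%N) * gauss_sum n.+1 K - gauss_sum n K)
  + 2 * ((1 - q ^+ (2 * n.+1)%N) * gauss_term n.+1 K.+1 - gauss_term n K.+1).
  ring.
rewrite IH; last lia.
(* With [n = j + K.+1] no truncated subtraction remains, and every power of [q] splits into a few
   atoms for [ring]. *)
have [j nE] : exists j, n = (j + K.+1)%N by exists (n - K.+1)%N; lia.
rewrite {IH Kn}/gauss_term.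
have -> : (n - K = j.+1)%N by lia.
have -> : (n.+1 - K.+1 = j.+1)%N by lia.
have -> : (n - K.+1 = j)%N by lia.
have -> : (n.+1 + K.+1 = (n.+1 + K).+1)%N by lia.
have -> : (n + K.+1 = (n.+1 + K))%N by lia.
rewrite (qtailS (m := j)) ?(qtailS (m := n.+1 + K)); try lia.
have -> : (K.+1 ^ 2 = K ^ 2 + K + K + 1)%N by rewrite !expnS; lia.
rewrite {}nE.
have -> : ((((j + K.+1).+1 + K).+1) = j + K + K + 1 + 1 + 1)%N by lia.
have -> : ((2 * (j + K.+1).+1) = j + j + K + K + 1 + 1 + 1 + 1)%N by lia.
have -> : (((j + K.+1).+1) = j + K + 1 + 1)%N by lia.
rewrite -!(addn1 j) -!(addn1 K) !exprD !expr1.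
move: (q ^+ (K ^ 2)%N) (q ^+ K) (q ^+ j) ((-1) ^+ K) (qtail _) (qtail _) => *.
by ring.
Qed.

(** At [K = n] the telescoped remainder cancels against the extreme term k = n + 1, because 1 -
    q^(2n+2) turns [qtail (2n+2)] into [qtail (2n+1)]. *)
Lemma gauss_sumS n : (2 * n.+1 <= M)%N ->
  (1 - q ^+ (2 * n.+1)%N) * gauss_sum n.+1 n.+1 = gauss_sum n n.
Proof.
move=> nM; have /eqP := gauss_sum_telescope (leqnn n) nM.
rewrite subr_eq => /eqP H.
have -> : gauss_sum n.+1 n.+1 = gauss_sum n.+1 n + 2 * gauss_term n.+1 n.+1.
  by rewrite /gauss_sum big_ord_recr /= mulrDr addrA.
rewrite mulrDr {}H.
rewrite /gauss_term !subnn.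
have -> : (n.+1 + n.+1 = (n.+1 + n).+1)%N by lia.
rewrite (qtailS (m := n.+1 + n)); last lia.
have -> : (n.+1 ^ 2 = n ^ 2 + n + n.+1)%N by rewrite !expnS; lia.
have -> : (2 * n.+1 = n.+1 + n.+1)%N by lia.
have -> : ((n.+1 + n).+1 = n.+1 + n.+1)%N by lia.
rewrite !(exprD _ _ n.+1) exprS (exprS (-1)).
by ring.
Qed.

(* As M, n -> oo this is (q;q) (-q;q) sum_k (-1)^k q^(k^2) = (q;q)^2. *)
Lemma finite_gauss n : (2 * n <= M)%N ->
  (\prod_(0 <= i < n) (1 - q ^+ i.+1)) * (\prod_(0 <= i < n) (1 + q ^+ i.+1))
    * gauss_sum n n = qtail 0 ^+ 2.
Proof.
elim: n => [_|n IH nM].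
  by rewrite !big_geq // /gauss_sum big_ord0 /gauss_term mulr0 addr0 expr2 !mul1r.
rewrite -IH -?(gauss_sumS nM); last lia.
rewrite !big_nat_recr //= (_ : 2 * n.+1 = n.+1 + n.+1)%N ?exprD; last lia.
by ring.
Qed.
End FiniteGauss.

(** * Power series as polynomials modulo ['X^N] *)

Definition eqX (R : nzSemiRingType) N (p r : {poly R}) :=
  forall i, (i < N)%N -> p`_i = r`_i.

Lemma eqX_refl (R : nzSemiRingType) N (p : {poly R}) : eqX N p p.
Proof. by []. Qed.

Lemma eqX_sym (R : nzSemiRingType) N (p r : {poly R}) : eqX N p r -> eqX N r p.
Proof. by move=> pr i iN; rewrite pr. Qed.

Lemma eqX_trans (R : nzSemiRingType) N (r p t : {poly R}) :
  eqX N p r -> eqX N r t -> eqX N p t.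
Proof. by move=> pr rt i iN; rewrite pr ?rt. Qed.

Lemma eqXD (R : nzSemiRingType) N (p p' r r' : {poly R}) :
  eqX N p p' -> eqX N r r' -> eqX N (p + r) (p' + r').
Proof. by move=> pp rr i iN; rewrite !coefD pp ?rr. Qed.

Lemma eqXZ (R : nzSemiRingType) N (c : R) (p r : {poly R}) :
  eqX N p r -> eqX N (c *: p) (c *: r).
Proof. by move=> pr i iN; rewrite !coefZ pr. Qed.

Lemma eqXM (R : nzSemiRingType) N (p p' r r' : {poly R}) :
  eqX N p p' -> eqX N r r' -> eqX N (p * r) (p' * r').
Proof.
move=> pp rr i iN; rewrite !coefM; apply: eq_bigr => j _.
by have ji := ltn_ord j; rewrite pp ?rr //; lia.
Qed.

Lemma eqX_mulXn (R : nzSemiRingType) N k M (p r : {poly R}) :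
  eqX M p r -> (N <= k + M)%N -> eqX N ('X^k * p) ('X^k * r).
Proof. by move=> pr NkM i iN; rewrite !coefXnM; case: ltnP => // ki; apply: pr; lia. Qed.

Lemma eqX_cancel (R : nzRingType) N (a p r : {poly R}) :
  a`_0 = 1 -> eqX N (a * p) (a * r) -> eqX N p r.
Proof.
move=> a0 apr i; elim/ltn_ind: i => i IH iN.
have := apr i iN; rewrite !coefM !big_ord_recl /= a0 !mul1r subn0.
rewrite (eq_bigr (fun j : 'I_i => a`_(lift ord0 j) * r`_(i - lift ord0 j))).
  exact: addIr.
move=> j _; have ji := ltn_ord j; rewrite IH //; rewrite /= /bump; lia.
Qed.

Lemma coef0_prod (R : comNzRingType) (I : Type) (s : seq I) (P : pred I)
    (F : I -> {poly R}) :
  (forall i, P i -> (F i)`_0 = 1) -> (\prod_(i <- s | P i) F i)`_0 = 1.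
Proof.
move=> F1; elim/big_rec: _ => [|i p Pi p0]; first by rewrite coef1.
by rewrite coef0M F1 // p0 mulr1.
Qed.

Lemma sqr_sum_mod2 (R : comNzRingType) (I : Type) (s : seq I) (F : I -> R) :
  exists r, (\sum_(i <- s) F i) ^+ 2 = \sum_(i <- s) F i ^+ 2 + 2 * r.
Proof.
elim: s => [|x s [r IH]]; first by exists 0; rewrite !big_nil; ring.
by exists (r + F x * \sum_(i <- s) F i); rewrite !big_cons sqrrD IH; ring.
Qed.

Lemma coef_monom_sum_eq0 (R : nzRingType) (I : Type) (s : seq I)
    (c : I -> R) (e : I -> nat) n :
  (forall i, e i <> n) -> (\sum_(i <- s) c i *: 'X^(e i))`_n = 0.
Proof.
move=> en; rewrite coef_sum big1 // => i _; rewrite coefZ coefXn.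
by case: eqP => [/esym/en //|]; rewrite mulr0.
Qed.

Lemma coef_monom_sum_mul_eq0 (R : comNzRingType) (I J : Type) (s : seq I) (t : seq J)
    (c : I -> R) (d : J -> R) (e : I -> nat) (f : J -> nat) n :
  (forall i j, (e i + f j)%N <> n) ->
  ((\sum_(i <- s) c i *: 'X^(e i)) * (\sum_(j <- t) d j *: 'X^(f j)))`_n = 0.
Proof.
move=> efn; rewrite big_distrl coef_sum big1 // => i _ /=.
rewrite big_distrr /=.
under eq_bigr do rewrite -scalerAl -scalerAr scalerA -exprD.
exact: coef_monom_sum_eq0.
Qed.

(** * Squares modulo 16 and powers of 1 + 2s modulo 32 *)

Lemma sqr_mod16 a : exists b,
  [\/ (a ^ 2 = 16 * b)%N, (a ^ 2 = 16 * b + 1)%N, (a ^ 2 = 16 * b + 4)%N |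
      (a ^ 2 = 16 * b + 9)%N].
Proof.
(* (8k + r)^2 = 16(4k^2 + kr) + r^2, so the residue modulo 8 decides. *)
have [k [r [r8 ->]]] : exists k r, (r < 8)%N /\ a = (8 * k + r)%N.
  by exists (a %/ 8)%N, (a %% 8)%N; lia.
case: r r8 => [_|[_|[_|[_|[_|[_|[_|[_|//]]]]]]]].
- by exists (4 * k ^ 2)%N; constructor 1; lia.
- by exists (4 * k ^ 2 + k)%N; constructor 2; lia.
- by exists (4 * k ^ 2 + 2 * k)%N; constructor 3; lia.
- by exists (4 * k ^ 2 + 3 * k)%N; constructor 4; lia.
- by exists (4 * k ^ 2 + 4 * k + 1)%N; constructor 1; lia.
- by exists (4 * k ^ 2 + 5 * k + 1)%N; constructor 4; lia.
- by exists (4 * k ^ 2 + 6 * k + 2)%N; constructor 3; lia.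
- by exists (4 * k ^ 2 + 7 * k + 3)%N; constructor 2; lia.
Qed.

Lemma pow13_one_add2 (s : {poly int}) :
  exists r, (1 + 2 * s) ^+ 13 =
    1 + 26 * s + 24 * s ^+ 2 + 16 * s ^+ 3 + 16 * s ^+ 4 + 32 * r.
Proof.
(* The coefficient of s^j is the quotient of 2^j binom(13, j) by 32; the nonzero remainders, at j =
   0, ..., 4, are 1, 26, 24, 16, 16. *)
exists (9 * s ^+ 2 + 71 * s ^+ 3 + 357 * s ^+ 4 + 1287 * s ^+ 5 + 2 * 1716 * s ^+ 6 +
  4 * 1716 * s ^+ 7 + 8 * 1287 * s ^+ 8 + 16 * 715 * s ^+ 9 + 32 * 286 * s ^+ 10 +
  64 * 78 * s ^+ 11 + 128 * 13 * s ^+ 12 + 256 * s ^+ 13).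
ring.
Qed.

(** Each of four squarings gains a factor 2: (1 + 2^k x)^2 = 1 + 2^(k+1) x (1 + 2^(k-1) x). *)
Lemma pow16_one_add2 (s : {poly int}) :
  exists r, (1 + 2 * s) ^+ 16 = 1 + 32 * r.
Proof.
pose a := s * (1 + s); pose b := a * (1 + 2 * a); pose c := b * (1 + 4 * b).
exists (c * (1 + 8 * c)).
have -> : (1 + 2 * s) ^+ 16 = (((1 + 2 * s) ^+ 2) ^+ 2 ^+ 2) ^+ 2 by ring.
have -> : (1 + 2 * s) ^+ 2 = 1 + 4 * a by rewrite /a; ring.
have -> : (1 + 4 * a) ^+ 2 = 1 + 8 * b by rewrite /b; ring.
have -> : (1 + 8 * b) ^+ 2 = 1 + 16 * c by rewrite /c; ring.
by ring.
Qed.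

Section Theta.
Variable N : nat.

(* Half of the nonconstant part of sum_k (-1)^k q^(k^2), up to |k| <= N. *)
Definition theta_half : {poly int} :=
  \sum_(0 <= k < N) (-1) ^+ k.+1 *: 'X^(k.+1 ^ 2)%N.

Lemma coef_pow13_theta n :
  exists z, ((1 + 2 * theta_half) ^+ 13)`_(16 * n + 14) = 32 * z.
Proof.
have [r ->] := pow13_one_add2 theta_half.
pose m := index_iota 0 N.
(* [d e] raises each term of [theta_half] to the power [e]; modulo 2, squaring sends [d e] to
   [d (2 * e)]. *)
pose d e : {poly int} := \sum_(k <- m) ((-1) ^+ k.+1) ^+ e *: 'X^(e * k.+1 ^ 2)%N.
have d1 : theta_half = d 1%N by apply: eq_bigr => k _; rewrite expr1 mul1n.
have dsq e : exists u, d e ^+ 2 = d (2 * e)%N + 2 * u.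
  have [u ->] := sqr_sum_mod2 m
    (fun k => ((-1) ^+ k.+1) ^+ e *: 'X^(e * k.+1 ^ 2)%N : {poly int}).
  exists u; congr (_ + _); apply: eq_bigr => k _.
  rewrite exprZn -!exprM; congr (_ ^+ _ *: 'X^_); last by rewrite mulnC mulnA.
  by rewrite -mulnA (mulnC e).
(* Reduce the cube and the fourth power modulo 2, by squaring termwise. *)
have [u s2] := dsq 1%N; have [v s4] := dsq 2%N.
rewrite d1.
have -> : 1 + 26 * d 1%N + 24 * d 1%N ^+ 2 + 16 * d 1%N ^+ 3 + 16 * d 1%N ^+ 4 + 32 * r
  = 1 + 26 * d 1%N + 24 * (d 1%N * d 1%N) + 16 * (d 1%N * d 2%N) + 16 * d 4%N
    + 32 * (r + u * d 1%N + v + 2 * u * d 2%N + 2 * u ^+ 2).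
  have -> : d 1%N ^+ 4 = d 4%N + 2 * (v + 2 * u * d 2%N + 2 * u ^+ 2).
    have -> : d 1%N ^+ 4 = (d 1%N ^+ 2) ^+ 2 by ring.
    by rewrite s2 (_ : 2 * 1 = 2)%N // sqrrD s4 (_ : 2 * 2 = 4)%N //; ring.
  have -> : d 1%N ^+ 3 = d 1%N * d 2%N + 2 * (u * d 1%N).
    by rewrite (exprS _ 2) s2 (_ : 2 * 1 = 2)%N //; ring.
  by ring.
have coefE (p1 p2 p3 p4 p5 : {poly int}) k1 k2 k3 k4 k5 i :
    (1 + p1 *+ k1 + p2 *+ k2 + p3 *+ k3 + p4 *+ k4 + p5 *+ k5)`_i =
    (i == 0%N)%:R + p1`_i *+ k1 + p2`_i *+ k2 + p3`_i *+ k3 + p4`_i *+ k4 + p5`_i *+ k5.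
  by rewrite !coefD !coefMn coef1.
rewrite !mulr_natl coefE.
rewrite (_ : (16 * n + 14 == 0)%N = false); last lia.
rewrite [(d 1%N)`_ _]coef_monom_sum_eq0; last first.
  by move=> k; have [b] := sqr_mod16 k.+1; case; lia.
rewrite [(d 4%N)`_ _]coef_monom_sum_eq0; last by move=> k; lia.
rewrite [(d 1%N * d 1%N)`_ _]coef_monom_sum_mul_eq0; last first.
  by move=> k l; have [b [] ?] := sqr_mod16 k.+1; have [b' [] ?] := sqr_mod16 l.+1; lia.
rewrite [(d 1%N * d 2%N)`_ _]coef_monom_sum_mul_eq0; last first.
  by move=> k l; have [b [] ?] := sqr_mod16 k.+1; have [b' [] ?] := sqr_mod16 l.+1; lia.
by rewrite !mul0rn !add0r; eexists; rewrite mulr_natl.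
Qed.
End Theta.

Lemma eqX_qtail (R : comNzRingType) N m M : (N <= m.+1)%N ->
  eqX N (qtail ('X : {poly R}) M m) 1.
Proof.
move=> Nm; rewrite /qtail big_seq_cond; elim/big_rec: _ => // i p.
rewrite andbT mem_index_iota => iM /eqXM IH; rewrite mulrC.
apply: (eqX_trans (IH (1 - 'X^(i.+1)) 1 _)); last by rewrite mulr1.
move=> j jN; rewrite coefB coefXn (_ : (j == i.+1) = false) ?subr0 //; lia.
Qed.

(** * Generating functions and their relation to theta *)

Section Series.
Variable N : nat.

Local Notation A n := (\prod_(0 <= i < n) (1 - 'X^(i.+1)) : {poly int}).
Local Notation B n := (\prod_(0 <= i < n) (1 + 'X^(i.+1)) : {poly int}).

(** Put [q = 'X] and [M = 2 * N] in [finite_gauss]: below degree N + 1 it reads A B phi = A^2, and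
    one factor A cancels. *)
Lemma eqX_gauss : eqX N.+1 (B N * (1 + 2 * theta_half N)) (A N).
Proof.
have A0 : (A N)`_0 = 1.
  by apply: coef0_prod => i _; rewrite coefB coef1 coefXn subr0.
apply: (eqX_cancel A0).
have AE : eqX N.+1 (qtail 'X (2 * N) 0) (A N).
  rewrite /qtail (@big_cat_nat _ _ _ N) //=; last lia.
  rewrite -[X in eqX _ _ X]mulr1; apply: eqXM => //.
  exact: eqX_qtail.
have := @finite_gauss _ ('X : {poly int}) (2 * N) N (leqnn _).
rewrite -mulrA => gE.
(* [qtail (N - k)] is 1 only modulo X^(N-k+1), but the factor X^(k^2) makes up for the loss since
   k^2 >= k. *)
have tE k : (k <= N)%N -> eqX N.+1 (gauss_term ('X : {poly int}) (2 * N) N k)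
    ((-1) ^+ k *: 'X^(k ^ 2)%N).
  move=> kN; rewrite /gauss_term -!mulrA -(signr_odd _ k) mulr_sign.
  rewrite -scaler_sign signr_odd -[X in eqX _ _ (_ *: X)]mulr1.
  apply: eqXZ; apply: (eqX_mulXn (M := (N - k).+1)); last by rewrite expnS expn1; nia.
  rewrite -[X in eqX _ _ X]mulr1.
  by apply: eqXM; apply: eqX_qtail; lia.
have SE : eqX N.+1 (gauss_sum 'X (2 * N) N N) (1 + 2 * theta_half N).
  apply: eqXD; first by move: (tE 0%N isT); rewrite expr0 scale1r.
  apply: eqXM => //; rewrite /theta_half big_mkord => i iN; rewrite !coef_sum.
  by apply: eq_bigr => k _; apply: tE.
apply: (@eqX_trans _ _ (A N * (B N * gauss_sum 'X (2 * N) N N))).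
  by do 2!apply: eqXM => //; apply: eqX_sym.
by rewrite gE expr2; apply: eqXM.
Qed.

Definition tails_gf m : {poly int} := \poly_(n < N.+1) (ntails m n)%:R.

(** This is [ntailsS] for generating functions, with the repeated part m + 1 moved to the left. The
    case [m = 0] is apart because no part has size 0. *)
Lemma tails_gfS m : eqX N.+1 ((1 - 'X^(m.+1)) * tails_gf m.+1)
  ((1 + (if m is 0 then 0 else 'X^m)) * tails_gf m).
Proof.
move=> n nN; rewrite mulrBl mulrDl !mul1r coefB coefD.
have -> : ((if m is 0 then 0 else 'X^m) * tails_gf m)`_n =
    (if (0 < m <= n)%N then ntails m (n - m) else 0%N)%:R.
  case: m => [|m]; first by rewrite mul0r coef0.
  by rewrite coefXnM coef_poly; case: ltnP => //= ?; rewrite ifT //; lia.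
rewrite coefXnM !coef_poly nN [in LHS]ntailsS !natrD.
rewrite (_ : (n < m.+1)%N = ~~ (m < n)%N); last lia.
case: (ltnP m n) => mn /=; last by rewrite subr0 add0r addrC.
rewrite (_ : (n - m.+1 < N.+1)%N = true); last lia.
ring.
Qed.

Lemma eqX_tails_gf : eqX N.+1 (A N * tails_gf N.+1) (B N).
Proof.
(* After a part m + 1, that size may recur but not be overlined: hence [A m.+1] against [B m]. *)
have AB m : eqX N.+1 (A m.+1 * tails_gf m.+1) (B m).
  elim: m => [|m IH].
    rewrite big_nat1 big_geq //; apply: (eqX_trans (tails_gfS 0)).
    by move=> n nN; rewrite addr0 mul1r coef_poly nN ntails0 coef1.
  rewrite big_nat_recr //= -mulrA [B _]big_nat_recr //=.
  apply: (eqX_trans (eqXM (eqX_refl _) (tails_gfS m.+1))) => /=.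
  by rewrite mulrCA mulrC; apply: eqXM.
(* The extra factor 1 - X^(N+1) of [A N.+1] is invisible below degree N + 1. *)
apply: eqX_trans (AB N); apply: eqXM => //.
rewrite big_nat_recr //= -[X in eqX _ X _]mulr1; apply: eqXM => //.
by move=> n nN; rewrite coefB coefXn (ltn_eqF nN) subr0.
Qed.

Lemma eqX_tails_gf_theta : eqX N.+1 (tails_gf N.+1 * (1 + 2 * theta_half N)) 1.
Proof.
have A0 : (A N)`_0 = 1.
  by apply: coef0_prod => i _; rewrite coefB coef1 coefXn subr0.
apply: (eqX_cancel A0); rewrite mulr1 mulrA.
apply: eqX_trans eqX_gauss; apply: eqXM => //; exact: eqX_tails_gf.
Qed.

Lemma pbar3_coef : (pbar3 N)%:R = (tails_gf N.+1 ^+ 3)`_N.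
Proof.
(* [Q] also contains overpartitions of weight above [N], so it matches [tails_gf] only up to degree
   [N]; its cube expands over triples. *)
pose Q : {poly int} :=
  \sum_(s : bounded_seq N | is_overpartition (parts s)) 'X^(weight (parts s)).
have QE : eqX N.+1 Q (tails_gf N.+1).
  move=> n nN; rewrite coef_sum coef_poly nN -card_overpartitions // -sum1_card natr_sum.
  rewrite big_mkcond [RHS]big_mkcond; apply: eq_bigr => s _; rewrite inE coefXn eq_sym.
  by case: is_overpartition => //=; case: eqP.
have Q3 : eqX N.+1 (Q * Q * Q) (tails_gf N.+1 ^+ 3).
  by rewrite !exprS expr0 mulr1 mulrA; do !apply: eqXM.
rewrite -Q3 // /Q big_distrlr pair_big big_distrlr pair_big /= coef_sum.
rewrite /pbar3 -sum1_card natr_sum big_mkcond [RHS]big_mkcond; apply: eq_bigr => t _.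
rewrite inE -!exprD coefXn eq_sym -andbA.
by do 3!case: is_overpartition => //=; case: eqP.
Qed.
End Series.

(** * The congruence modulo 32 *)

Lemma pbar3_16n14 n : exists z : int, (pbar3 (16 * n + 14))%:R = 32 * z.
Proof.
set N := (16 * n + 14)%N; pose phi := 1 + 2 * theta_half N.
have [r phi16] := pow16_one_add2 (theta_half N).
have [z phi13] := coef_pow13_theta N n.
pose P := tails_gf N N.+1.
(* As [P * phi] is 1 up to degree [N], three factors [phi] absorb P^3; no inverse of [phi] has to be
   formed. *)
have E : eqX N.+1 (P ^+ 3 * phi ^+ 16) (phi ^+ 13).
  have -> : P ^+ 3 * phi ^+ 16 =
    (P * phi) * ((P * phi) * ((P * phi) * phi ^+ 13)) by ring.
  do 3!rewrite -[X in eqX _ _ X]mul1r.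
  by do 3!(apply: eqXM; first exact: eqX_tails_gf_theta).
have := E N (ltnSn N).
rewrite phi13 phi16 mulrDr mulr1 mulrCA coefD -pbar3_coef.
rewrite [32 * (_ * r)]mulr_natl coefMn -[_ *+ 32]mulr_natl => pE.
by exists (z - (P ^+ 3 * r)`_N); rewrite mulrBr -pE addrK.
Qed.

Local Close Scope ring_scope.

Theorem theorem2p8 (n : nat) : pbar3 (16 * n + 14) = 0 %[mod 32].
Proof. by have [z] := pbar3_16n14 n; lia. Qed.
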